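(* Let $H$ and $A$ be bialgebras over $\Bbbk$. If $(H,A)$ is a matched pair (of bialgebras), with action $\cdot:H\otimes A\to A$ and coaction $\rho:H\to H\otimes A$, then $(H,A)$ is a weak matched pair (with the same action and coaction).
   Context: Everything is over a fixed field $\Bbbk$, $\otimes=\otimes_\Bbbk$; algebras are associative and unital, coalgebras coassociative and counital; Sweedler notation $\Delta(h)=h_1\otimes h_2$ (summation understood). A weak bialgebra $H$ is an algebra and a coalgebra such that $\Delta(hk)=\Delta(h)\Delta(k)$; $\varepsilon(hk\ell)=\varepsilon(hk_1)\varepsilon(k_2\ell)=\varepsilon(hk_2)\varepsilon(k_1\ell)$; and $(1_H\otimes\Delta(1_H))(\Delta(1_H)\otimes 1_H)=(\Delta(1_H)\otimes 1_H)(1_H\otimes\Delta(1_H))=\Delta^2(1_H)$, where $\Delta^2=(\Delta\otimes \mathrm{id})\Delta$. Every bialgebra is a weak bialgebra. Write $\Delta(1_H)=1_{H1}\otimes 1_{H2}$; primes denote further copies. Put $\varepsilon_t(h)=\varepsilon(1_{H1}h)1_{H2}$ and $\varepsilon_s(h)=1_{H1}\varepsilon(h1_{H2})$ (similarly for $A$); in a bialgebra both equal $\varepsilon(h)1_H$. For a weak bialgebra $H$ and an algebra $A$, $A$ is a left $H$-module algebra if there is a linear map $\cdot:H\otimes A\to A$ with $1_H\cdot a=a$; $h\cdot ab=(h_1\cdot a)(h_2\cdot b)$; $h\cdot(k\cdot a)=hk\cdot a$; $h\cdot 1_A=\varepsilon_t(h)\cdot 1_A$. For a weak bialgebra $A$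 and a coalgebra $H$, $H$ is a right $A$-comodule coalgebra if there is a linear map $\rho:H\to H\otimes A$, $\rho(h)=h^0\otimes h^1$, with $\varepsilon(h^1)h^0=h$; ${h^0}_1\otimes{h^0}_2\otimes h^1={h_1}^0\otimes{h_2}^0\otimes{h_1}^1{h_2}^1$; $h^{00}\otimes h^{01}\otimes h^1=h^0\otimes{h^1}_1\otimes{h^1}_2$; $h^1\varepsilon(h^0)=\varepsilon_s(h^1)\varepsilon(h^0)$. Here $h^{00}\otimes h^{01}\otimes h^1=(\rho\otimes\mathrm{id})\rho(h)$, ${h_1}^0\otimes {h_1}^1$ is $\rho$ applied to the leg $h_1$, and ${h^0}_1\otimes{h^0}_2$ is $\Delta$ applied to the leg $h^0$. Matched pair of bialgebras $(H,A)$: (i) $A$ is a left $H$-module algebra via $\cdot$; (ii) $H$ is a right $A$-comodule coalgebra via $\rho$; (iii) $\rho(hg)=\rho(h_1)(g^0\otimes(h_2\cdot g^1))$; (iv) $\Delta(h\cdot x)=({h_1}^0\cdot x_1)\otimes({h_1}^1(h_2\cdot x_2))$; (v) $\varepsilon(h\cdot x)=\varepsilon(h)\varepsilon(x)$; (vi) $\rho(1_H)=1_H\otimes 1_A$; for all $h,g\in H$, $x\in A$. Weak matched pair: a pair $(H,A)$ of weak bialgebras such that (i) $A$ is a left $H$-module algebra via $\cdot$; (ii) $H$ is a right $A$-comodule coalgebra via $\rho$; (iii) $(h_2g)^0\otimes(h_1\cdot x)_1\otimes(h_1\cdot x)_2(h_2g)^1={h_3}^0g^0\otimes({h_1}^0\cdot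 x_1)\otimes{h_1}^1(h_2\cdot x_2){h_3}^1(h_4\cdot g^1)$; (iv) $\varepsilon_s(h\cdot x)=\varepsilon_s(h\cdot 1_A)\varepsilon_s(x)$; (v) $\rho(1_{H1})\otimes 1_{H2}=1_{H1}\otimes\varepsilon({1_{H1}'}^0){1_{H1}'}^1\otimes 1_{H2}1_{H2}'$; for all $h,g\in H$, $x\in A$. *)

(* Defs.v *)
From HB Require Import structures.
From mathcomp Require Import all_boot all_algebra.
From mathcomp Require Import boolp classical_sets.
From mathcomp Require Import finmap monalg.

Set Implicit Arguments.
Unset Strict Implicit.
Unset Printing Implicit Defensive.

Import GRing.Theory.
Local Open Scope ring_scope.
Local Open Scope quotient_scope.

Section TensorDef.
Context (K : fieldType) (U V : lmodType K).

Notation free := {malg K[(U * V)%type]}.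

(* Membership in the subspace spanned by the bilinearity relations; the       *)
(* tensor product is the quotient of the free vector space on U * V by it.    *)
Inductive tensor_null : free -> Prop :=
| tensor_null0 : tensor_null 0
| tensor_nullDl c a u u' v x : tensor_null x ->
    tensor_null (c *: (<< (a *: u + u', v) >>
                       - (a *: << (u, v) >> + << (u', v) >>)) + x)
| tensor_nullDr c a u v v' x : tensor_null x ->
    tensor_null (c *: (<< (u, a *: v + v') >>
                       - (a *: << (u, v) >> + << (u, v') >>)) + x).

Lemma tensor_nullD x y : tensor_null x -> tensor_null y -> tensor_null (x + y).
Proof.
move=> nx ny; elim: nx => [|c a u u' v z _ IH|c a u v v' z _ IH].
- by rewrite add0r.
- by rewrite -addrA; apply: tensor_nullDl.
- by rewrite -addrA; apply: tensor_nullDr.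
Qed.

Lemma tensor_nullZ b x : tensor_null x -> tensor_null (b *: x).
Proof.
elim=> [|c a u u' v z _ IH|c a u v v' z _ IH].
- by rewrite scaler0; apply: tensor_null0.
- by rewrite scalerDr scalerA; apply: tensor_nullDl.
- by rewrite scalerDr scalerA; apply: tensor_nullDr.
Qed.

Definition tensor_nullb : {pred free} := fun x => `[< tensor_null x >].

Lemma tensor_nullbP x : reflect (tensor_null x) (x \in tensor_nullb).
Proof. exact: asboolP. Qed.

Fact tensor_null_closed : zmod_closed tensor_nullb.
Proof.
split; first by apply/tensor_nullbP; apply: tensor_null0.
move=> x y /tensor_nullbP nx /tensor_nullbP ny; apply/tensor_nullbP.
by rewrite -scaleN1r; apply: tensor_nullD => //; apply: tensor_nullZ.
Qed.

HB.instance Definition _ :=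
  GRing.isZmodClosed.Build free tensor_nullb tensor_null_closed.

Definition tensor : Type := Quotient.quot tensor_nullb.
HB.instance Definition _ := GRing.Zmodule.on tensor.

Definition tensor_pi (x : free) : tensor := \pi_(Quotient.quot tensor_nullb) x.
Definition tensor_repr (t : tensor) : free :=
  repr (t : Quotient.quot tensor_nullb).

Lemma tensor_reprK : cancel tensor_repr tensor_pi.
Proof. exact: reprK. Qed.

Lemma tensor_piP x y : tensor_pi x = tensor_pi y <-> tensor_null (x - y).
Proof.
rewrite /tensor_pi; split.
  by move=> /eqP; rewrite -Quotient.idealrBE => /tensor_nullbP.
by move=> /tensor_nullbP; rewrite Quotient.idealrBE => /eqP.
Qed.

Lemma tensor_piD x y : tensor_pi (x + y) = tensor_pi x + tensor_pi y.
Proof. exact: (raddfD (\pi_(Quotient.quot tensor_nullb))). Qed.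

Lemma tensor_pi0 : tensor_pi 0 = 0.
Proof. exact: (raddf0 (\pi_(Quotient.quot tensor_nullb))). Qed.

Definition tensor_scale (a : K) (t : tensor) := tensor_pi (a *: tensor_repr t).

Lemma tensor_piZ a x : tensor_scale a (tensor_pi x) = tensor_pi (a *: x).
Proof.
apply/tensor_piP; rewrite -scalerBr; apply: tensor_nullZ; apply/tensor_piP.
exact: tensor_reprK.
Qed.

Fact tensor_scalerA a b t :
  tensor_scale a (tensor_scale b t) = tensor_scale (a * b) t.
Proof. by rewrite -[t]tensor_reprK !tensor_piZ scalerA. Qed.
Fact tensor_scale1r : left_id 1 tensor_scale.
Proof. by move=> t; rewrite -[t]tensor_reprK tensor_piZ scale1r. Qed.
Fact tensor_scalerDr : right_distributive tensor_scale +%R.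
Proof.
move=> a s t; rewrite -[s]tensor_reprK -[t]tensor_reprK.
by rewrite -tensor_piD !tensor_piZ scalerDr tensor_piD.
Qed.
Fact tensor_scalerDl t : {morph tensor_scale^~ t : a b / a + b}.
Proof.
by move=> a b; rewrite -[t]tensor_reprK !tensor_piZ scalerDl tensor_piD.
Qed.

HB.instance Definition _ := GRing.Zmodule_isLmodule.Build K tensor
  tensor_scalerA tensor_scale1r tensor_scalerDr tensor_scalerDl.

Lemma tensor_pi_linear : linear tensor_pi.
Proof. by move=> a x y; rewrite tensor_piD -tensor_piZ. Qed.

Definition tens (u : U) (v : V) : tensor := tensor_pi << (u, v) >>.

(* The linear map induced by a bilinear f, computed on a representative in    *)
(* the free vector space. Its value means nothing when f is not bilinear.     *)
Definition tsum (W : lmodType K) (t : tensor) (f : U -> V -> W) : W :=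
  let x := tensor_repr t in \sum_(k <- msupp x) x@_k *: f k.1 k.2.

End TensorDef.

Arguments tensor {K} (U V)%_type_scope.

Notation "U ⊗ V" := (tensor U V)
  (at level 38, right associativity) : type_scope.
Notation "u ⊗ v" := (tens u v)
  (at level 38, right associativity) : ring_scope.

(* Sweedler notation: \tsum_(a ⊗ b <- t) F is the sum of the F a_i b_i for    *)
(* any expression of t as a sum of tensors a_i ⊗ b_i; F is to be bilinear in  *)
(* a and b (see tsum_tens and tsum_linear).                                   *)
Notation "\tsum_ ( a ⊗ b <- t ) F" := (tsum t (fun a b => F))
  (at level 41, a name, b name, t at level 50, F at level 41,
   format "'[' \tsum_ ( a  ⊗  b  <-  t ) '/  '  F ']'") : ring_scope.

Section TensorTheory.
Context (K : fieldType) (U V : lmodType K).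
Implicit Types (u : U) (v : V) (t : U ⊗ V).

Lemma tens_linearl v : linear (fun u => u ⊗ v : U ⊗ V).
Proof.
move=> a u u'; rewrite /tens -tensor_pi_linear; apply/tensor_piP.
rewrite -[X in tensor_null X]scale1r -[X in tensor_null X]addr0.
exact/tensor_nullDl/tensor_null0.
Qed.

Lemma tens_linearr u : linear (fun v => u ⊗ v : U ⊗ V).
Proof.
move=> a v v'; rewrite /tens -tensor_pi_linear; apply/tensor_piP.
rewrite -[X in tensor_null X]scale1r -[X in tensor_null X]addr0.
exact/tensor_nullDr/tensor_null0.
Qed.

Lemma tensor_ind (P : U ⊗ V -> Prop) :
    P 0 -> (forall a u v t, P t -> P (a *: (u ⊗ v) + t)) ->
  forall t, P t.
Proof.
move=> P0 PD t; rewrite -[t]tensor_reprK (monalgE (tensor_repr t)).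
elim: (enum_fset _) => [|[u v] s IH] /=; first by rewrite big_nil tensor_pi0.
rewrite big_cons tensor_piD.
set c := (_@__); have -> : << c *g (u, v) >> = c *: << (u, v) >> :> {malg K[_]}.
  by apply/malgP=> k; rewrite mcoeffZ !mcoeffU mulrnAr mulr1.
by rewrite -tensor_piZ; apply: PD.
Qed.

Section Lift.
Context (W : lmodType K) (f : U -> V -> W).
Hypothesis f_linl : forall v, linear (fun u => f u v).
Hypothesis f_linr : forall u, linear (f u).

Let ev (x : {malg K[(U * V)%type]}) : W :=
  \sum_(k <- msupp x) x@_k *: f k.1 k.2.

Let evw x (D : {fset (U * V)%type}) : (msupp x `<=` D)%fset ->
  ev x = \sum_(k <- D) x@_k *: f k.1 k.2.
Proof.
move=> sxD; rewrite /ev (big_fset_incl _ sxD) // => k _ /mcoeff_outdom ->.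
by rewrite scale0r.
Qed.

Let ev_linear : linear ev.
Proof.
move=> a x y; pose D := (msupp x `|` msupp y)%fset.
have sx : (msupp x `<=` D)%fset by apply: fsubsetUl.
have sy : (msupp y `<=` D)%fset by apply: fsubsetUr.
have sxy : (msupp (a *: x + y) `<=` D)%fset.
  apply: fsubset_trans (msuppD_le _ _) _; rewrite fsubUset sy andbT.
  exact: fsubset_trans (msuppZ_le _ _) sx.
rewrite (evw sx) (evw sy) (evw sxy) scaler_sumr -big_split /=.
by apply: eq_bigr => k _; rewrite mcoeffD mcoeffZ scalerDl scalerA.
Qed.

Let evU u v : ev << (u, v) >> = f u v.
Proof.
by rewrite (evw (msuppU_le)) big_seq_fset1 mcoeffUU scale1r.
Qed.

HB.instance Definition _ := GRing.isLinear.Build K _ W *:%R ev ev_linear.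

Let ev_null x : tensor_null x -> ev x = 0.
Proof.
elim=> [|c a u u' v z _ IH|c a u v v' z _ IH]; first exact: raddf0.
- by rewrite linearP linearB linearP /= !evU f_linl subrr scaler0 add0r.
- by rewrite linearP linearB linearP /= !evU f_linr subrr scaler0 add0r.
Qed.

Let tsum_pi x : tsum (tensor_pi x) f = ev x.
Proof.
apply/eqP; rewrite -subr_eq0 -[tsum _ _]/(ev _) -linearB /= ev_null //.
by apply/tensor_piP; rewrite tensor_reprK.
Qed.

Lemma tsum_tens u v : tsum (u ⊗ v) f = f u v.
Proof. by rewrite tsum_pi evU. Qed.

Lemma tsum_linear : linear (fun t => tsum t f).
Proof.
move=> a s t; rewrite -[s]tensor_reprK -[t]tensor_reprK.
by rewrite -tensor_pi_linear !tsum_pi linearP.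
Qed.

End Lift.

Lemma tsumD (W : lmodType K) (a : K) (f g : U -> V -> W) t :
  \tsum_(u ⊗ v <- t) (a *: f u v + g u v)
  = a *: (\tsum_(u ⊗ v <- t) f u v) + \tsum_(u ⊗ v <- t) g u v.
Proof.
rewrite /tsum scaler_sumr -big_split /=; apply: eq_bigr => k _.
by rewrite scalerDr !scalerA mulrC.
Qed.

Lemma eq_tsum (W : lmodType K) (f g : U -> V -> W) t :
  (forall u v, f u v = g u v) -> tsum t f = tsum t g.
Proof. by move=> fg; apply: eq_bigr => k _; rewrite fg. Qed.

Lemma tensor_ext (W : lmodType K) (f g : U ⊗ V -> W) :
    linear f -> linear g -> (forall u v, f (u ⊗ v) = g (u ⊗ v)) -> f =1 g.
Proof.
move=> fL gL fg t; elim/tensor_ind: t => [|a u v t IH].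
  have E (h : U ⊗ V -> W) : linear h -> h 0 = 0.
    by move=> hL; rewrite -[X in h X](subrr 0) -scaleN1r addrC hL scaleN1r addNr.
  by rewrite !E.
by rewrite fL gL fg IH.
Qed.

End TensorTheory.

Lemma linear_form_exists (K : fieldType) (V : lmodType K) (v : V) :
  v != 0 -> exists2 f : V -> K^o, linear f & f v = 1.
Proof.
move=> v0; pose P (S : set V) :=
  (forall a x y, S x -> S y -> S (a *: x + y)) /\ ~ S v.
have [F FP Ftot|M [[MD Mv] Mmax]] := @Zorn_bigcup V P.
  split=> [a x y [S FS Sx] [T FT Ty]|[S FS]]; last exact: (FP _ FS).2.
  case: (Ftot _ _ FS FT) => [ST|TS].
    by exists T => //; apply: (FP _ FT).1 => //; apply: ST.
  by exists S => //; apply: (FP _ FS).1 => //; apply: TS.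
have M0 : M 0.
  apply: contrapT => nM0.
  have Mn x : ~ M x.
    by move=> Mx; apply: nM0; rewrite -[0](addNr x) -scaleN1r; apply: MD.
  have : (M `<` [set (0 : V)])%classic.
    by split=> [x /Mn //|/(_ 0 erefl)].
  move=> /Mmax; apply; split=> [a x y -> ->|v0E]; first by rewrite scaler0 addr0.
  by rewrite v0E eqxx in v0.
have MZ a x : M x -> M (a *: x) by move=> Mx; rewrite -[_ *: _]addr0; apply: MD.
have exc w : exists c, M (w - c *: v).
  have [Mw|nMw] := pselect (M w); first by exists 0; rewrite scale0r subr0.
  pose B : set V := fun y => exists2 x, M x & exists b, y = x + b *: w.
  have : ~ P B.
    apply: Mmax; split=> [x Mx|BM].
      by exists x => //; exists 0; rewrite scale0r addr0.
    by apply: nMw; apply: BM; exists 0 => //; exists 1; rewrite scale1r add0r.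
  move=> nPB; have : B v.
    apply: contrapT => nBv; apply: nPB; split=> // a _ _ [x Mx [b ->]] [y My [c ->]].
    exists (a *: x + y); first exact: MD.
    by exists (a * b + c); rewrite scalerDr scalerA addrACA -scalerDl.
  move=> [x Mx [b vE]]; have b0 : b != 0.
    by apply/eqP => b0; apply: Mv; rewrite vE b0 scale0r addr0.
  exists b^-1; rewrite vE scalerDr scalerA mulVf // scale1r opprD addrCA subrr addr0.
  by rewrite -scalerN -scaleN1r; apply/MZ/MZ.
have uniq w c d : M (w - c *: v) -> M (w - d *: v) -> c = d.
  move=> Mc Md; apply/eqP; rewrite -subr_eq0; apply: contrapT => /negP cd.
  apply: Mv; rewrite -[v]scale1r -(mulVf cd) -scalerA; apply: MZ.
  suff -> : (c - d) *: v = (-1) *: (w - c *: v) + (w - d *: v) by apply: MD.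
  by rewrite scaleN1r opprB addrA subrK scalerBl.
have /cid[f fM] : exists f : V -> K, forall w, M (w - f w *: v).
  by exists (fun w => projT1 (cid (exc w))) => w; case: cid.
exists f => [a x y|]; last by apply: (uniq v) (fM v) _; rewrite scale1r subrr.
apply: (uniq (a *: x + y)) (fM _) _.
rewrite [X in _ - X *: v](_ : _ = a * f x + f y) // scalerDl -scalerA.
rewrite opprD addrACA -scalerBr.
exact: MD.
Qed.

Section TensorAlgebra.
Context (K : fieldType) (A B : algType K).
Implicit Types s t : A ⊗ B.

Definition tensor_mul s t : A ⊗ B :=
  \tsum_(a ⊗ b <- s) \tsum_(c ⊗ d <- t) (a * c) ⊗ (b * d).

Let mul_bil (a : A) (b : B)
    (f := fun (c : A) (d : B) => (a * c) ⊗ (b * d) : A ⊗ B) :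
  (forall d, linear (f^~ d)) /\ (forall c, linear (f c)).
Proof.
split=> [d k x y|c k x y]; rewrite /f mulrDr -scalerAr.
  exact: tens_linearl.
exact: tens_linearr.
Qed.

Let mul_bil2 t (f := fun (a : A) (b : B) =>
    \tsum_(c ⊗ d <- t) (a * c) ⊗ (b * d) : A ⊗ B) :
  (forall b, linear (f^~ b)) /\ (forall a, linear (f a)).
Proof.
split=> [d k x y|c k x y]; rewrite /f -tsumD; apply: eq_tsum => a b.
  by rewrite mulrDl -scalerAl; apply: tens_linearl.
by rewrite mulrDl -scalerAl; apply: tens_linearr.
Qed.

Lemma tensor_mul_linl t : linear (tensor_mul^~ t).
Proof. by have [? ?] := mul_bil2 t; apply: tsum_linear. Qed.

Lemma tensor_mul_linr s : linear (tensor_mul s).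
Proof.
move=> k x y; rewrite /tensor_mul -tsumD; apply: eq_tsum => a b.
by have [fl fr] := mul_bil a b; apply: (tsum_linear fl fr).
Qed.

Lemma tensor_mulE a b c d :
  tensor_mul (a ⊗ b) (c ⊗ d) = (a * c) ⊗ (b * d).
Proof.
have [fl fr] := mul_bil2 (c ⊗ d); rewrite /tensor_mul (tsum_tens fl fr).
by have [gl gr] := mul_bil a b; rewrite (tsum_tens gl gr).
Qed.

Let tens_ext (f g : A ⊗ B -> A ⊗ B) : linear f -> linear g ->
  (forall a b, f (a ⊗ b) = g (a ⊗ b)) -> forall t, f t = g t.
Proof. exact: tensor_ext. Qed.

Fact tensor_mulA : associative tensor_mul.
Proof.
move=> r s t.
pose ml := tensor_mul_linl; pose mr := tensor_mul_linr.
apply: (tens_ext (f := fun r => tensor_mul r (tensor_mul s t))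
  (g := fun r => tensor_mul (tensor_mul r s) t)) => [||a b].
- exact: ml.
- by move=> k x y; rewrite !ml.
apply: (tens_ext (f := fun s => tensor_mul (a ⊗ b) (tensor_mul s t))
  (g := fun s => tensor_mul (tensor_mul (a ⊗ b) s) t)) => [||c d].
- by move=> k x y; rewrite ml mr.
- by move=> k x y; rewrite mr ml.
apply: (tens_ext (f := fun t => tensor_mul (a ⊗ b) (tensor_mul (c ⊗ d) t))
  (g := fun t => tensor_mul (tensor_mul (a ⊗ b) (c ⊗ d)) t)) => [||e f].
- by move=> k x y; rewrite !mr.
- exact: mr.
by rewrite !tensor_mulE !mulrA.
Qed.

Fact tensor_mul1l : left_id (1 ⊗ 1) tensor_mul.
Proof.
apply: tens_ext => [||a b]; first exact: tensor_mul_linr.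
  by [].
by rewrite tensor_mulE !mul1r.
Qed.

Fact tensor_mul1r : right_id (1 ⊗ 1) tensor_mul.
Proof.
apply: tens_ext => [||a b]; first exact: tensor_mul_linl.
  by [].
by rewrite tensor_mulE !mulr1.
Qed.

Fact tensor_mulDl : left_distributive tensor_mul +%R.
Proof.
by move=> x y t; have := tensor_mul_linl t 1 x y; rewrite !scale1r.
Qed.

Fact tensor_mulDr : right_distributive tensor_mul +%R.
Proof.
by move=> s x y; have := tensor_mul_linr s 1 x y; rewrite !scale1r.
Qed.

Fact tensor_oner_neq0 : 1 ⊗ 1 != 0 :> A ⊗ B.
Proof.
have [f fL f1] := linear_form_exists (oner_neq0 A).
have [g gL g1] := linear_form_exists (oner_neq0 B).
pose h a b : K^o := f a *: g b.
have hl b : linear (h^~ b).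
  by move=> k x y; rewrite /h fL scalerDl -scalerA.
have hr a : linear (h a).
  by move=> k x y; rewrite /h gL scalerDr !scalerA mulrC.
apply/eqP => E; have := tsum_tens hl hr 1 1; rewrite E /h f1 g1.
have /(_ (-1) 0 0) := tsum_linear hl hr.
rewrite scaler0 addr0 scaleN1r addNr => ->; rewrite scale1r => /eqP.
by rewrite eq_sym oner_eq0.
Qed.

HB.instance Definition _ := GRing.Zmodule_isNzRing.Build (A ⊗ B)%type
  tensor_mulA tensor_mul1l tensor_mul1r tensor_mulDl tensor_mulDr
  tensor_oner_neq0.

Fact tensor_scalerAl (k : K) s t : k *: (s * t) = (k *: s) * t.
Proof.
have E := tensor_mul_linl t k s 0.
have E0 : tensor_mul 0 t = 0 := mul0r t.
by rewrite addr0 E0 addr0 in E.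
Qed.

Fact tensor_scalerAr (k : K) s t : k *: (s * t) = s * (k *: t).
Proof.
have E := tensor_mul_linr s k t 0.
have E0 : tensor_mul s 0 = 0 := mulr0 s.
by rewrite addr0 E0 addr0 in E.
Qed.

HB.instance Definition _ :=
  GRing.Lmodule_isLalgebra.Build K (A ⊗ B)%type tensor_scalerAl.
HB.instance Definition _ :=
  GRing.Lalgebra_isAlgebra.Build K (A ⊗ B)%type tensor_scalerAr.

Lemma tens1E : 1 ⊗ 1 = 1 :> A ⊗ B.
Proof. by []. Qed.

Lemma tensM (a c : A) (b d : B) :
  (a ⊗ b) * (c ⊗ d) = (a * c) ⊗ (b * d) :> A ⊗ B.
Proof. exact: tensor_mulE. Qed.

End TensorAlgebra.

HB.mixin Record Lmodule_isCoalgebra (K : fieldType) C of GRing.Lmodule K C := {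
  comul : {linear C -> (C ⊗ C)%type};
  counit : {scalar C};
  comulA : forall h : C,
    \tsum_(h1 ⊗ h2 <- comul h) \tsum_(h11 ⊗ h12 <- comul h1) h11 ⊗ (h12 ⊗ h2)
    = \tsum_(h1 ⊗ h2 <- comul h) \tsum_(h21 ⊗ h22 <- comul h2) h1 ⊗ (h21 ⊗ h22);
  counitl : forall h : C, \tsum_(h1 ⊗ h2 <- comul h) counit h1 *: h2 = h;
  counitr : forall h : C, \tsum_(h1 ⊗ h2 <- comul h) counit h2 *: h1 = h
}.

#[short(type="coalgType")]
HB.structure Definition Coalgebra (K : fieldType) :=
  { C of Lmodule_isCoalgebra K C & GRing.Lmodule K C }.

(* No compatibility between the algebra and the coalgebra is required here.   *)
#[short(type="algCoalgType")]
HB.structure Definition AlgCoalgebra (K : fieldType) :=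
  { H of GRing.Algebra K H & Coalgebra K H }.

Notation Δ := comul.
Notation ε := counit.

Section Bialgebras.
Context (K : fieldType) (H : algCoalgType K).
Implicit Types h k l : H.

Record bialgebra : Prop := {
  bialg_comulM : forall h k, Δ (h * k) = Δ h * Δ k;
  bialg_comul1 : Δ (1 : H) = 1 ⊗ 1;
  bialg_counitM : forall h k, ε (h * k) = ε h * ε k;
  bialg_counit1 : ε (1 : H) = 1
}.

(* Threefold tensor products are bracketed to the right; comul2 is            *)
(* (Δ ⊗ id) Δ and comul1_tens1 is Δ(1) ⊗ 1 after this reassociation.          *)
Definition comul2 h : H ⊗ H ⊗ H :=
  \tsum_(h1 ⊗ h2 <- Δ h) \tsum_(h11 ⊗ h12 <- Δ h1) h11 ⊗ (h12 ⊗ h2).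

Definition comul1_tens1 : H ⊗ H ⊗ H := \tsum_(u ⊗ v <- Δ (1 : H)) u ⊗ (v ⊗ 1).

Record weak_bialgebra : Prop := {
  wbialg_comulM : forall h k, Δ (h * k) = Δ h * Δ k;
  wbialg_counit12 : forall h k l,
    ε (h * k * l) = \tsum_(k1 ⊗ k2 <- Δ k) (ε (h * k1) * ε (k2 * l) : K^o);
  wbialg_counit21 : forall h k l,
    ε (h * k * l) = \tsum_(k1 ⊗ k2 <- Δ k) (ε (h * k2) * ε (k1 * l) : K^o);
  wbialg_comul1l : (1 ⊗ Δ 1) * comul1_tens1 = comul2 1;
  wbialg_comul1r : comul1_tens1 * (1 ⊗ Δ 1) = comul2 1
}.

Definition counit_t h : H := \tsum_(u ⊗ v <- Δ (1 : H)) ε (u * h) *: v.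
Definition counit_s h : H := \tsum_(u ⊗ v <- Δ (1 : H)) ε (h * v) *: u.

End Bialgebras.

Arguments bialgebra {K} H.
Arguments weak_bialgebra {K} H.

Notation ε_t := counit_t.
Notation ε_s := counit_s.

Section ModuleAlgebra.
Context (K : fieldType) (H : algCoalgType K) (A : algType K).
Context (act : {linear (H ⊗ A)%type -> A}).
Local Notation "h ▷ a" := (act (h ⊗ a)) (at level 35, right associativity).

Record module_algebra : Prop := {
  modalg_act1 : forall a : A, 1 ▷ a = a;
  modalg_actM : forall (h : H) (a b : A),
    h ▷ (a * b) = \tsum_(h1 ⊗ h2 <- Δ h) (h1 ▷ a) * (h2 ▷ b);
  modalg_actA : forall (h k : H) (a : A), h ▷ (k ▷ a) = (h * k) ▷ a;
  modalg_act_unit : forall h : H, h ▷ 1 = ε_t h ▷ 1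
}.

End ModuleAlgebra.

Section ComoduleCoalgebra.
Context (K : fieldType) (H : coalgType K) (A : algCoalgType K).
Context (rho : {linear H -> (H ⊗ A)%type}).

Record comodule_coalgebra : Prop := {
  comodcoalg_counit_coact : forall h : H,
    \tsum_(h0 ⊗ h1 <- rho h) ε h1 *: h0 = h;
  comodcoalg_comul : forall h : H,
    \tsum_(x ⊗ y <- rho h) \tsum_(x1 ⊗ x2 <- Δ x) x1 ⊗ (x2 ⊗ y)
    = \tsum_(h1 ⊗ h2 <- Δ h)
        \tsum_(x1 ⊗ y1 <- rho h1) \tsum_(x2 ⊗ y2 <- rho h2)
          x1 ⊗ (x2 ⊗ (y1 * y2));
  comodcoalg_coactA : forall h : H,
    \tsum_(x ⊗ y <- rho h) \tsum_(x0 ⊗ x1 <- rho x) x0 ⊗ (x1 ⊗ y)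
    = \tsum_(x ⊗ y <- rho h) \tsum_(y1 ⊗ y2 <- Δ y) x ⊗ (y1 ⊗ y2);
  comodcoalg_counit : forall h : H,
    \tsum_(h0 ⊗ h1 <- rho h) ε h0 *: h1
    = \tsum_(h0 ⊗ h1 <- rho h) ε h0 *: ε_s h1
}.

End ComoduleCoalgebra.

Section MatchedPairs.
Context (K : fieldType) (H A : algCoalgType K).
Context (act : {linear (H ⊗ A)%type -> A}) (rho : {linear H -> (H ⊗ A)%type}).
Local Notation "h ▷ a" := (act (h ⊗ a)) (at level 35, right associativity).

Record matched_pair : Prop := {
  mp_bialgl : bialgebra H;
  mp_bialgr : bialgebra A;
  mp_modalg : module_algebra act;
  mp_comodcoalg : comodule_coalgebra rho;
  mp_coactM : forall h g : H,
    rho (h * g) = \tsum_(h1 ⊗ h2 <- Δ h) \tsum_(g0 ⊗ g1 <- rho g)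
                    rho h1 * (g0 ⊗ (h2 ▷ g1));
  mp_comul_act : forall (h : H) (x : A),
    Δ (h ▷ x) = \tsum_(h1 ⊗ h2 <- Δ h) \tsum_(x1 ⊗ x2 <- Δ x)
                  \tsum_(a0 ⊗ a1 <- rho h1) (a0 ▷ x1) ⊗ (a1 * (h2 ▷ x2));
  mp_counit_act : forall (h : H) (x : A), ε (h ▷ x) = ε h * ε x;
  mp_coact1 : rho 1 = 1 ⊗ 1
}.

(* Four-fold Sweedler legs h1, h2, h3, h4 are produced by applying Δ to the   *)
(* last leg: h ↦ h1 ⊗ r1, r1 ↦ h2 ⊗ r2, r2 ↦ h3 ⊗ h4.                          *)
Record weak_matched_pair : Prop := {
  wmp_wbialgl : weak_bialgebra H;
  wmp_wbialgr : weak_bialgebra A;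
  wmp_modalg : module_algebra act;
  wmp_comodcoalg : comodule_coalgebra rho;
  wmp_compat : forall (h g : H) (x : A),
    \tsum_(h1 ⊗ h2 <- Δ h)
      \tsum_(p ⊗ q <- rho (h2 * g)) \tsum_(y1 ⊗ y2 <- Δ (h1 ▷ x))
        p ⊗ (y1 ⊗ (y2 * q))
    = \tsum_(h1 ⊗ r1 <- Δ h) \tsum_(h2 ⊗ r2 <- Δ r1) \tsum_(h3 ⊗ h4 <- Δ r2)
        \tsum_(a0 ⊗ a1 <- rho h1) \tsum_(b0 ⊗ b1 <- rho h3)
        \tsum_(g0 ⊗ g1 <- rho g) \tsum_(x1 ⊗ x2 <- Δ x)
          (b0 * g0) ⊗ ((a0 ▷ x1) ⊗ (a1 * (h2 ▷ x2) * b1 * (h4 ▷ g1)));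
  wmp_counit_s_act : forall (h : H) (x : A),
    ε_s (h ▷ x) = ε_s (h ▷ 1) * ε_s x;
  wmp_coact1 :
    \tsum_(u ⊗ v <- Δ (1 : H)) \tsum_(u0 ⊗ u1 <- rho u) u0 ⊗ (u1 ⊗ v)
    = \tsum_(u ⊗ v <- Δ (1 : H)) \tsum_(u' ⊗ v' <- Δ (1 : H))
        \tsum_(p ⊗ q <- rho u') u ⊗ ((ε p *: q) ⊗ (v * v'))
}.

End MatchedPairs.

(* Main.v *)
(** Over bialgebras [Δ 1 = 1 ⊗ 1] and [ε] is multiplicative, so the axioms
    about [ε_s] and [Δ 1] trivialize. The mixed compatibility (iii) follows by
    expanding [ρ (h2 g)] and [Δ (h1 ▷ x)] with the two matched pair identities;
    both sides then differ only by coassociativity. *)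

Require Import Defs.
From mathcomp Require Import all_boot all_algebra.

Set Implicit Arguments.
Unset Strict Implicit.
Unset Printing Implicit Defensive.

Import GRing.Theory.
Local Open Scope ring_scope.

(** Both sides are finite sums over the same chosen representative of [t], so [L] passes through
    term by term. *)
Lemma linear_tsum (K : fieldType) (U V W W' : lmodType K) (L : W -> W') (t : U ⊗ V)
    (f : U -> V -> W) :
  linear L -> L (tsum t f) = \tsum_(u ⊗ v <- t) L (f u v).
Proof.
move=> L_lin; have L0 : L 0 = 0.
  by rewrite -[X in L X](subrr 0) -scaleN1r addrC L_lin scaleN1r addNr.
have LD x y : L (x + y) = L x + L y by have := L_lin 1 x y; rewrite !scale1r.
rewrite /tsum (big_morph L LD L0); apply: eq_bigr => k _.
by rewrite -[X in L X]addr0 L_lin L0 addr0.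
Qed.

Lemma exchange_tsum (K : fieldType) (U V U' V' W : lmodType K) (s : U ⊗ V) (t : U' ⊗ V')
    (f : U -> V -> U' -> V' -> W) :
  \tsum_(a ⊗ b <- s) \tsum_(c ⊗ d <- t) f a b c d
  = \tsum_(c ⊗ d <- t) \tsum_(a ⊗ b <- s) f a b c d.
Proof.
rewrite /tsum; under eq_bigr do rewrite scaler_sumr.
rewrite exchange_big; apply: eq_bigr => k _ /=.
by rewrite scaler_sumr; apply: eq_bigr => l _; rewrite !scalerA mulrC.
Qed.

(** The representative of the inner tensor is unrelated to those of the [F a b], so bilinearity of
    [f] enters: it makes [tsum _ f] a linear map on [U ⊗ V]. *)
Lemma tsum_tsum (K : fieldType) (U V U' V' W : lmodType K) (t : U' ⊗ V')
    (F : U' -> V' -> (U ⊗ V)%type) (f : U -> V -> W) :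
    (forall v, linear (f^~ v)) -> (forall u, linear (f u)) ->
  tsum (tsum t F) f = \tsum_(a ⊗ b <- t) tsum (F a b) f.
Proof.
by move=> fl fr; apply: (linear_tsum (L := fun s => tsum s f));
  apply: tsum_linear.
Qed.

Section Linearity.
Context (K : fieldType) (X : lmodType K).

Lemma linear_idfun : linear (fun x : X => x).
Proof. by []. Qed.

Lemma linear_comp (U V : lmodType K) (L : {linear U -> V}) (f : X -> U) :
  linear f -> linear (fun x => L (f x)).
Proof. by move=> fL a x y; rewrite fL linearP. Qed.

Lemma linear_tensl (U V : lmodType K) (f : X -> U) (v : V) :
  linear f -> linear (fun x => f x ⊗ v).
Proof. by move=> fL a x y; rewrite fL tens_linearl. Qed.

Lemma linear_tensr (U V : lmodType K) (u : U) (f : X -> V) :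
  linear f -> linear (fun x => u ⊗ f x).
Proof. by move=> fL a x y; rewrite fL tens_linearr. Qed.

Lemma linear_mull (A : algType K) (f : X -> A) (b : A) :
  linear f -> linear (fun x => f x * b).
Proof. by move=> fL a x y; rewrite fL mulrDl scalerAl. Qed.

Lemma linear_mulr (A : algType K) (b : A) (f : X -> A) :
  linear f -> linear (fun x => b * f x).
Proof. by move=> fL a x y; rewrite fL mulrDr scalerAr. Qed.

Lemma linear_scalel (U V : lmodType K) (L : {scalar U}) (f : X -> U) (v : V) :
  linear f -> linear (fun x => L (f x) *: v).
Proof. by move=> fL a x y; rewrite fL linearP scalerDl scalerA. Qed.

Lemma linear_scaler (V : lmodType K) (c : K) (f : X -> V) :
  linear f -> linear (fun x => c *: f x).
Proof. by move=> fL a x y; rewrite fL scalerDr !scalerA mulrC. Qed.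

Lemma linear_tsum_body (U V W : lmodType K) (t : U ⊗ V) (f : X -> U -> V -> W) :
  (forall u v, linear (fun x => f x u v)) -> linear (fun x => tsum t (f x)).
Proof. by move=> fL a x y; rewrite -tsumD; apply: eq_tsum => u v; rewrite fL. Qed.

Lemma linear_tsum_range (U V W : lmodType K) (g : X -> (U ⊗ V)%type)
    (f : U -> V -> W) :
  linear g -> (forall v, linear (f^~ v)) -> (forall u, linear (f u)) ->
  linear (fun x => tsum (g x) f).
Proof. by move=> gL fl fr a x y; rewrite gL tsum_linear. Qed.

End Linearity.

(* [linearity] tests whether an argument depends on the variable by trying to
   unify; without opacity a failing test unfolds these constants and diverges. *)
#[local] Opaque tens tsum GRing.mul.

Ltac linearity := intros;
  lazymatch goal with |- context [GRing.linear_for _ ?f] =>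
    (* Eta-expansion brings partial applications into the [fun x => ...] shape that the patterns
       below expect. *)
    let g := eval cbv beta in (fun x => f x) in
    lazymatch g with
    | fun x => x => exact: linear_idfun
    | fun x => tsum _ _ =>
        first [apply linear_tsum_body | apply linear_tsum_range]; linearity
    | fun x => _ ⊗ _ =>
        first [apply linear_tensl | apply linear_tensr]; linearity
    | fun x => _ * _ =>
        first [apply linear_mull | apply linear_mulr]; linearity
    | fun x => _ *: _ =>
        first [apply linear_scaler | apply linear_scalel]; linearity
    | _ => apply linear_comp; linearity
    end
  end.

(** By the universal property of the tensor product, the trilinear [G] induces a linear map [P] on
    [C ⊗ C ⊗ C]; applying [P] to both sides of [comulA] gives the claim. *)
Lemma comul_coassoc (K : fieldType) (C : coalgType K) (W : lmodType K)
    (G : C -> C -> C -> W) (h : C) :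
    (forall b c, linear (fun a => G a b c)) ->
    (forall a c, linear (fun b => G a b c)) ->
    (forall a b, linear (G a b)) ->
  \tsum_(h1 ⊗ h2 <- Δ h) \tsum_(h11 ⊗ h12 <- Δ h1) G h11 h12 h2
  = \tsum_(h1 ⊗ h2 <- Δ h) \tsum_(h21 ⊗ h22 <- Δ h2) G h1 h21 h22.
Proof.
move=> G1 G2 G3; pose P a (s : C ⊗ C) := tsum s (G a).
have Pl s : linear (P^~ s).
  by move=> k x y; rewrite /P -tsumD; apply: eq_tsum => u v; apply: G1.
have Pr a : linear (P a) by apply: tsum_linear.
have PE a b c : P a (b ⊗ c) = G a b c by apply: tsum_tens.
transitivity (tsum (\tsum_(h1 ⊗ h2 <- Δ h)
    \tsum_(h11 ⊗ h12 <- Δ h1) h11 ⊗ (h12 ⊗ h2)) P); last rewrite comulA.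
  rewrite (tsum_tsum _ _ Pl Pr); apply: eq_tsum => a b.
  rewrite (tsum_tsum _ _ Pl Pr); apply: eq_tsum => c d.
  by rewrite (tsum_tens Pl Pr) PE.
rewrite (tsum_tsum _ _ Pl Pr); apply: eq_tsum => a b.
rewrite (tsum_tsum _ _ Pl Pr); apply: eq_tsum => c d.
by rewrite (tsum_tens Pl Pr) PE.
Qed.

Lemma tensor_mul_tens (K : fieldType) (A B : algType K) (t : A ⊗ B) (c : A)
    (d : B) : t * (c ⊗ d) = \tsum_(a ⊗ b <- t) (a * c) ⊗ (b * d).
Proof.
by apply: eq_tsum => a b; rewrite tsum_tens; [by [] | by linearity | by linearity].
Qed.

Section Bialgebra.
Context (K : fieldType) (H : algCoalgType K).
Hypothesis bialgH : bialgebra H.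

Lemma tsum_comul1 (W : lmodType K) (f : H -> H -> W) :
    (forall v, linear (f^~ v)) -> (forall u, linear (f u)) ->
  tsum (Δ (1 : H)) f = f 1 1.
Proof. by move=> fl fr; rewrite (bialg_comul1 bialgH) tsum_tens. Qed.

(** Apply [ε] to the left counit law. *)
Lemma counit_comul (h : H) :
  \tsum_(h1 ⊗ h2 <- Δ h) (ε h1 * ε h2 : K^o) = ε h.
Proof.
rewrite -[in RHS](counitl h) (linear_tsum (L := ε : H -> K^o)); last exact: linearP.
by apply: eq_tsum => a b; rewrite linearZ.
Qed.

Lemma counit_s_bialgebra (h : H) : ε_s h = ε h *: 1.
Proof.
rewrite /counit_s tsum_comul1 ?mulr1 // => u a x y.
  by rewrite scalerDr !scalerA mulrC.
by rewrite mulrDr -scalerAr linearP scalerDl scalerA.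
Qed.

Lemma bialgebra_weak : weak_bialgebra H.
Proof.
have c1 : comul1_tens1 H = 1.
  rewrite /comul1_tens1 tsum_comul1; [by [] | by linearity | by linearity].
have c2 : comul2 (1 : H) = 1.
  rewrite /comul2 tsum_comul1; [|by linearity | by linearity].
  rewrite tsum_comul1; [by [] | by linearity | by linearity].
have eM := bialg_counitM bialgH.
(* Multiplicativity gives [ε h * ε l * ε k], and [counit_comul] splits [ε k]. Both weak counit
   axioms are rearrangements of this sum, because the scalars commute. *)
have e3 (h k l : H) : ε (h * k * l)
    = \tsum_(k1 ⊗ k2 <- Δ k) (ε h * ε l * (ε k1 * ε k2) : K^o).
  rewrite -(linear_tsum (L := fun c : K^o => ε h * ε l * c : K^o)).
    by rewrite counit_comul !eM mulrAC.
  by move=> a x y; rewrite mulrDr scalerAr.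
split=> [|h k l|h k l||]; first exact: bialg_comulM.
- rewrite e3; apply: (eq_tsum (W := K^o)) => a b.
  by rewrite !eM mulrACA [ε l * _]mulrC.
- rewrite e3; apply: (eq_tsum (W := K^o)) => a b.
  by rewrite !eM [ε a * _]mulrC mulrACA [ε l * _]mulrC.
- by rewrite c1 c2 (bialg_comul1 bialgH) mulr1.
- by rewrite c1 c2 (bialg_comul1 bialgH) mul1r.
Qed.

End Bialgebra.

Section MatchedPair.
Context (K : fieldType) (H A : algCoalgType K).
Context (act : {linear (H ⊗ A)%type -> A}) (rho : {linear H -> (H ⊗ A)%type}).
Hypothesis mp : matched_pair act rho.

(** This is [mp_coactM] pushed through a bilinear [f], with the sum over [rho h1] moved outside that
    over [rho g] to follow the order of [wmp_compat]. *)
Lemma matched_pair_tsum_coactM (W : lmodType K) (f : H -> A -> W) (h g : H) :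
    (forall v, linear (f^~ v)) -> (forall u, linear (f u)) ->
  tsum (rho (h * g)) f
  = \tsum_(h1 ⊗ h2 <- Δ h) \tsum_(b0 ⊗ b1 <- rho h1) \tsum_(g0 ⊗ g1 <- rho g)
      f (b0 * g0) (b1 * act (h2 ⊗ g1)).
Proof.
move=> fl fr; rewrite (mp_coactM mp) (tsum_tsum _ _ fl fr).
apply: eq_tsum => h1 h2; rewrite (tsum_tsum _ _ fl fr) exchange_tsum.
apply: eq_tsum => g0 g1; rewrite tensor_mul_tens (tsum_tsum _ _ fl fr).
by apply: eq_tsum => b0 b1; rewrite (tsum_tens fl fr).
Qed.

Lemma matched_pair_tsum_comul_act (W : lmodType K) (f : A -> A -> W) (h : H)
    (x : A) :
    (forall v, linear (f^~ v)) -> (forall u, linear (f u)) ->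
  tsum (Δ (act (h ⊗ x))) f
  = \tsum_(h1 ⊗ h2 <- Δ h) \tsum_(a0 ⊗ a1 <- rho h1) \tsum_(x1 ⊗ x2 <- Δ x)
      f (act (a0 ⊗ x1)) (a1 * act (h2 ⊗ x2)).
Proof.
move=> fl fr; rewrite (mp_comul_act mp) (tsum_tsum _ _ fl fr).
apply: eq_tsum => h1 h2; rewrite (tsum_tsum _ _ fl fr) exchange_tsum.
apply: eq_tsum => x1 x2; rewrite (tsum_tsum _ _ fl fr).
by apply: eq_tsum => a0 a1; rewrite (tsum_tens fl fr).
Qed.

End MatchedPair.

Theorem proposition3p5 (K : fieldType) (H A : algCoalgType K)
    (act : {linear (H ⊗ A)%type -> A}) (rho : {linear H -> (H ⊗ A)%type}) :
  bialgebra H -> bialgebra A ->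
  matched_pair act rho -> weak_matched_pair act rho.
Proof.
move=> bH bA mp; split.
- exact: bialgebra_weak.
- exact: bialgebra_weak.
- exact: mp_modalg mp.
- exact: mp_comodcoalg mp.
- move=> h g x.
  (* [G] keeps the last leg [r] unsplit, so the right side of [wmp_compat] is its right-bracketed
     sum. On the left, [rho (h2 * g)] splits the second leg of [h] and [Δ (h1 ▷ x)] the first, which
     gives the left-bracketed sum. *)
  pose G h1 h2 r :=
    \tsum_(h3 ⊗ h4 <- Δ r)
      \tsum_(a0 ⊗ a1 <- rho h1) \tsum_(b0 ⊗ b1 <- rho h3)
      \tsum_(g0 ⊗ g1 <- rho g) \tsum_(x1 ⊗ x2 <- Δ x)
        (b0 * g0) ⊗ (act (a0 ⊗ x1) ⊗
          (a1 * act (h2 ⊗ x2) * b1 * act (h4 ⊗ g1))).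
  transitivity (\tsum_(h1 ⊗ h2 <- Δ h) \tsum_(h11 ⊗ h12 <- Δ h1) G h11 h12 h2).
    apply: eq_tsum => h1 r.
    rewrite (matched_pair_tsum_coactM mp); try by linearity.
    (* The sums over [Δ r], [rho h3] and [rho g] are moved, one at a time, outside the sum over
       [Δ h1], so that only the expansion of [Δ (h1 ▷ x)] remains. *)
    rewrite /G [RHS]exchange_tsum; apply: eq_tsum => h3 h4.
    under [RHS]eq_tsum => h11 h12 do rewrite exchange_tsum.
    rewrite [RHS]exchange_tsum; apply: eq_tsum => b0 b1.
    under [RHS]eq_tsum => h11 h12 do rewrite exchange_tsum.
    rewrite [RHS]exchange_tsum; apply: eq_tsum => g0 g1.
    rewrite (matched_pair_tsum_comul_act mp); try by linearity.
    by do 3! (apply: eq_tsum => ? ?); rewrite !mulrA.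
  by apply: comul_coassoc; rewrite /G; linearity.
(* Both sides equal [(ε h * ε x) *: 1]. *)
- move=> h x; rewrite !counit_s_bialgebra // !(mp_counit_act mp).
  by rewrite (bialg_counit1 bA) mulr1 -scalerAl mul1r scalerA.
(* Both sides collapse to [1 ⊗ (1 ⊗ 1)]. *)
- rewrite [LHS]tsum_comul1; [|by []|by linearity|by linearity].
  rewrite (mp_coact1 mp) [LHS]tsum_tens; [|by linearity|by linearity].
  rewrite [RHS]tsum_comul1; [|by []|by linearity|by linearity].
  rewrite [RHS]tsum_comul1; [|by []|by linearity|by linearity].
  rewrite (mp_coact1 mp) [RHS]tsum_tens; [|by linearity|by linearity].
  by rewrite (bialg_counit1 bH) scale1r mulr1.
Qed.
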